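(* Let $F(n)$ denote the number of incidence matrices with exactly $n$ ones. Then, as $n\to\infty$, $$F(n)\sim \frac{n!}{4}\,e^{-\frac12(\log 2)^2}\,\frac{1}{(\log 2)^{2n+2}},$$ where $a_n\sim b_n$ means $\lim_{n\to\infty}a_n/b_n=1$.
   Context: An incidence matrix is a zero-one matrix (of any finite size) with no zero rows and no zero columns. For $n\in\mathbb N$, $F(n)$ is the number of incidence matrices having exactly $n$ entries equal to $1$ (matrices of different shapes are counted separately; e.g. $F(2)=4$). *)

(* Defs.v *)
From HB Require Import structures.
From mathcomp Require Import all_boot all_order all_algebra finmap.
From mathcomp Require Import all_classical all_reals all_analysis.

Set Implicit Arguments.
Unset Strict Implicit.
Unset Printing Implicit Defensive.

Local Open Scope classical_set_scope.
Local Open Scope nat_scope.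

Definition incidence (p q : nat) (M : 'M[bool]_(p, q)) : bool :=
  [forall i, [exists j, M i j]] && [forall j, [exists i, M i j]].

Definition num_ones (p q : nat) (M : 'M[bool]_(p, q)) : nat :=
  #|[pred ij : 'I_p * 'I_q | M ij.1 ij.2]|.

(* The shape is part of the data, so matrices of different shapes differ. *)
Notation any_matrix := {s : nat * nat & 'M[bool]_(s.1, s.2)}.

Definition incidence_matrices (n : nat) : set any_matrix :=
  [set M | incidence (tagged M) /\ num_ones (tagged M) = n].

(* [fset_set] is a genuine conversion only on finite sets; finiteness is
   [finite_incidence_matrices] below. *)
Definition F (n : nat) : nat := #|` fset_set (incidence_matrices n) |%fset.

Lemma incidence_bounds (p q : nat) (M : 'M[bool]_(p, q)) :
  incidence M -> p <= num_ones M /\ q <= num_ones M.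
Proof.
case/andP=> /forallP hr /forallP hc; split.
- have /fin_all_exists[f hf] : forall i, exists j, M i j.
    by move=> i; apply/existsP.
  rewrite -[X in X <= _]card_ord
    -(@fintype.card_image _ _ (fun i => (i, f i)) _ predT).
    by apply/subset_leq_card/fintype.subsetP => _ /fintype.imageP[i _ ->];
      rewrite inE /= hf.
  by move=> i j [].
- have /fin_all_exists[f hf] : forall j, exists i, M i j.
    by move=> j; apply/existsP.
  rewrite -[X in X <= _]card_ord
    -(@fintype.card_image _ _ (fun j => (f j, j)) _ predT).
    by apply/subset_leq_card/fintype.subsetP => _ /fintype.imageP[i _ ->];
      rewrite inE /= hf.
  by move=> i j [].
Qed.

Notation bounded_matrix n :=
  {s : 'I_n.+1 * 'I_n.+1 & 'M[bool]_(s.1, s.2)}.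

Definition unbound (n : nat) (M : bounded_matrix n) : any_matrix :=
  existT (fun s : nat * nat => 'M[bool]_(s.1, s.2))
    (val (tag M).1, val (tag M).2) (tagged M).

Lemma unbound_inj (n : nat) : injective (@unbound n).
Proof.
move=> [[[p hp] [q hq]] M] [[[p' hp'] [q' hq']] M'] /= e.
have [e1 e2] : p = p' /\ q = q' by have [] := congr1 (@projT1 _ _) e.
move: hp' hq' M' e; rewrite -e1 -e2 => hp' hq'.
rewrite (bool_irrelevance hp' hp) (bool_irrelevance hq' hq) => M' /=.
by rewrite /unbound /= => /eqP; rewrite eq_Tagged => /eqP /= ->.
Qed.

Lemma incidence_matricesE (n : nat) : incidence_matrices n =
  @unbound n @` [set M | incidence (tagged M) /\ num_ones (tagged M) = n].
Proof.
apply/seteqP; split => [[[p q] M] /= [hM hn]|_ [[s M] /= hM <-]] //.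
have [] := incidence_bounds hM.
rewrite hn -(ltnS p) -(ltnS q) => hp hq.
by exists (existT (fun s : 'I_n.+1 * 'I_n.+1 => 'M[bool]_(s.1, s.2))
  (Ordinal hp, Ordinal hq) M).
Qed.

Lemma finite_incidence_matrices (n : nat) : finite_set (incidence_matrices n).
Proof. by rewrite incidence_matricesE; apply/finite_image/finite_finset. Qed.

Lemma F_sum (n : nat) : F n = \sum_(p < n.+1) \sum_(q < n.+1)
  #|[pred M : 'M[bool]_(p, q) | incidence M && (num_ones M == n)]|.
Proof.
rewrite /F incidence_matricesE fset_set_image; last exact: finite_finset.
rewrite card_imfset /=; last exact: unbound_inj.
set P := [pred M : bounded_matrix n |
  incidence (tagged M) && (num_ones (tagged M) == n)].
have -> : [set M : bounded_matrix n |
    incidence (tagged M) /\ num_ones (tagged M) = n] = [set` P].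
  by apply/seteqP; split => M /=; [case=> ? ?; apply/andP; split => //; apply/eqP
    | case/andP => ? /eqP].
have -> : #|` fset_set [set` P]| = #|P|.
  rewrite cardE; apply/perm_size/uniq_perm; rewrite ?fset_uniq ?enum_uniq //.
  move=> M; rewrite in_fset_set; last exact: finite_finset.
  by rewrite mem_enum; apply/idP/idP; rewrite inE.
rewrite pair_big -sum1_card.
rewrite [RHS](eq_bigr (fun s : 'I_n.+1 * 'I_n.+1 =>
  \sum_(M : 'M[bool]_(s.1, s.2) | incidence M && (num_ones M == n)) 1)).
  by rewrite sig_big_dep.
by move=> s _; rewrite sum1_card.
Qed.

(* Main.v *)
(** Write a(k) for the number of ordered set partitions of a k-set (the Fubini
numbers) and s(n, k) for the signed Stirling numbers of the first kind.
Sorting the n-subsets of A x B by their row and column supports, and expanding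
the falling factorial (|A| |B|)^_n into powers, gives
<<n! F(n) = sum_k s(n, k) a(k)^2>>.

The recurrence of a(k) is a renewal equation for u(k) = a(k) (log 2)^k / k!
with step weights (log 2)^i / i!, i >= 1, whose sum is 1.  The tails r(j) of
these weights satisfy sum_j r(j) = 2 log 2 and r(0) = 1; since 2 log 2 - 1 < 1,
convolution with r is invertible in l^1, so that u(k) --> 1 / (2 log 2).

Put x(n, j) = |s(n, n - j)| ((n - j)! / n!)^2.  The Stirling recurrence becomes
<<x(n+1, j+1) = (1 - (j+1)/(n+1))^2 x(n, j+1) + n/(n+1)^2 x(n, j)>>,
from which x(n, j) <= 1 / j! and x(n, j) --> 1 / (2^j j!).  By dominated
convergence the normalised F(n) tends to
sum_j (-1)^j (log 2)^(2j) / (2^j j!) = exp (- (log 2)^2 / 2). *)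

Require Import Defs.
From mathcomp Require Import all_boot all_order all_algebra.
From mathcomp Require Import all_classical all_reals all_analysis.
From mathcomp Require Import ring lra zify.
Import Order.TTheory GRing.Theory Num.Theory.
Import numFieldNormedType.Exports.
Set Implicit Arguments.
Unset Strict Implicit.
Unset Printing Implicit Defensive.

Local Open Scope nat_scope.

(** * Surjection, Stirling and Fubini numbers *)

(* Surjections from a [k]-set onto an [m]-set, by the fibre of the last point. *)
Fixpoint surj_num (m k : nat) : nat :=
  if m is m'.+1 then \sum_(j < k) 'C(k, j) * surj_num m' j else (k == 0).

(* [stirling1_rev n j] is the unsigned Stirling number c(n, n - j). *)
Fixpoint stirling1_rev (n j : nat) : nat :=
  if n is n'.+1 then
    stirling1_rev n' j + (if j is j'.+1 then n' * stirling1_rev n' j' else 0)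
  else (j == 0).

(** A surjection onto an ordered [m]-set is an ordered partition into [m] blocks. *)
Definition fubini_num (k : nat) : nat := \sum_(m < k.+1) surj_num m k.

Lemma surj_num_gt (m k : nat) : k < m -> surj_num m k = 0.
Proof.
elim: m k => // m IHm k; rewrite ltnS => lekm /=.
by rewrite big1 // => j _; rewrite IHm ?muln0 // (leq_trans (ltn_ord j)).
Qed.

(** Every map is a surjection onto its image. In the induction on [x], Pascal's rule separates the
    images avoiding the new point, which give [x ^ k], from those containing it, which give the
    other terms of the binomial expansion of [x.+1 ^ k]. *)
Lemma expn_surj_num (x k : nat) :
  x ^ k = \sum_(m < x.+1) 'C(x, m) * surj_num m k.
Proof.
elim: x k => [|x IHx] k; first by rewrite big_ord1 bin0 mul1n; case: k => [|k]; rewrite ?(@exp0n k.+1).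
rewrite big_ord_recl bin0 mul1n.
under eq_bigr => m _ do rewrite lift0 binS mulnDl.
rewrite big_split /= addnA; set s := (X in _ + X).
have -> : (k == 0) + \sum_(m < x.+1)
    'C(x, m.+1) * (\sum_(j < k) 'C(k, j) * surj_num m j) = x ^ k.
  rewrite IHx [RHS]big_ord_recl bin0 mul1n; congr addn.
  by rewrite [LHS]big_ord_recr /= bin_small // mul0n addn0.
rewrite -(add1n x) expnDn big_ord_recr /= binn mul1n exp1n mul1n addnC.
congr addn; rewrite /s.
under [RHS]eq_bigr => m _ do rewrite big_distrr.
rewrite exchange_big /=; apply: eq_bigr => j _.
rewrite exp1n mul1n IHx big_distrr /=; apply: eq_bigr => m _.
by rewrite mulnCA.
Qed.

Lemma sum_subset_card (T : finType) (A : {set T}) (g : nat -> nat) :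
  \sum_(B : {set T} | B \subset A) g #|B| = \sum_(m < #|A|.+1) 'C(#|A|, m) * g m.
Proof.
rewrite (partition_big (fun B : {set T} => inord #|B| : 'I_#|A|.+1) predT) //=.
apply: eq_bigr => m _.
rewrite -cards_draws -[X in X * _]sum1_card big_distrl /=.
under [RHS]eq_bigl => B do rewrite inE.
apply: congr_big => //= [B|B /andP[sBA /eqP <-]].
  have [sBA|//] := boolP (B \subset A); rewrite /= -val_eqE /= inordK //.
  by rewrite ltnS subset_leq_card.
by rewrite mul1n inordK // ltnS subset_leq_card.
Qed.

Lemma sum_subset_surj_num (T : finType) (A : {set T}) (k : nat) :
  \sum_(B : {set T} | B \subset A) surj_num #|B| k = #|A| ^ k.
Proof. by rewrite (sum_subset_card A (surj_num^~ k)) -expn_surj_num. Qed.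

Lemma fubini_num_widen (n k : nat) : k < n ->
  \sum_(m < n) surj_num m k = fubini_num k.
Proof.
move=> ltkn; rewrite /fubini_num.
rewrite [RHS](big_ord_widen_cond n predT (fun m => surj_num m k)) //.
rewrite [RHS]big_mkcond; apply: eq_bigr => m _ /=.
by case: ltnP => // ltjm; rewrite surj_num_gt.
Qed.

(** Here [j] counts the elements outside the last block, which is nonempty. *)
Lemma fubini_num_rec (k : nat) :
  fubini_num k = (k == 0) + \sum_(j < k) 'C(k, j) * fubini_num j.
Proof.
rewrite {1}/fubini_num big_ord_recl; congr addn.
under eq_bigr => m _ do rewrite lift0 /=.
rewrite exchange_big /=; apply: eq_bigr => j _.
by rewrite -big_distrr /= fubini_num_widen.
Qed.

Lemma stirling1_rev_gt (n j : nat) : n < j -> stirling1_rev n j = 0.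
Proof.
elim: n j => [|n IHn] [|j] //=; rewrite ltnS => ltnj.
by rewrite !IHn ?muln0 // ltnW.
Qed.

(** * Sets of cells with prescribed row and column supports *)

Section SupportCount.
Variables (I J : finType) (n : nat).
Implicit Types (A : {set I}) (B : {set J}) (E : {set I * J}).

(** For full [A] and [B] these are the incidence matrices; arbitrary supports allow an inversion
    over subsets. *)
Definition supported_sets A B : {set {set I * J}} :=
  [set E : {set I * J} | [&& #|E| == n, [set x.1 | x in E] == A & [set x.2 | x in E] == B]].

(** Each [n]-subset of the product of [A] and [B] has exactly one pair of projections. *)
Lemma sum_supported_sets A B :
  \sum_(AB : {set I} * {set J} | (AB.1 \subset A) && (AB.2 \subset B))
    #|supported_sets AB.1 AB.2| = 'C(#|A| * #|B|, n).
Proof.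
rewrite -cardsX -cards_draws -sum1_card.
rewrite (partition_big (fun E : {set I * J} => ([set x.1 | x in E], [set x.2 | x in E]))
  (fun AB : {set I} * {set J} => (AB.1 \subset A) && (AB.2 \subset B))) /=.
  apply: eq_bigr => -[A' B'] /= /andP[sA sB]; rewrite -sum1_card.
  apply: eq_bigl => E; rewrite !inE xpair_eqE.
  case: eqP => //=; rewrite ?andbF // => _.
  have [/andP[/eqP eA /eqP eB]|] := boolP (_ && _); rewrite ?andbF ?andbT //.
  symmetry; apply/fintype.subsetP => x Ex; rewrite inE; apply/andP; split.
    by apply: (fintype.subsetP sA); rewrite -eA; apply/imsetP; exists x.
  by apply: (fintype.subsetP sB); rewrite -eB; apply/imsetP; exists x.
move=> E; rewrite inE => /andP[/fintype.subsetP sE _]; apply/andP; split.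
  by apply/fintype.subsetP => _ /imsetP[x /sE + ->]; rewrite inE => /andP[].
by apply/fintype.subsetP => _ /imsetP[x /sE + ->]; rewrite inE => /andP[].
Qed.

End SupportCount.

Local Open Scope ring_scope.

(** * The exact formula for [F] in Stirling and Fubini numbers *)

Section StirlingFormula.
Variable R : comNzRingType.

Lemma ffact_stirling1_rev (x n : nat) : (x ^_ n)%:R =
  \sum_(j < n.+1) (-1) ^+ j * (stirling1_rev n j)%:R * x%:R ^+ (n - j) :> R.
Proof.
elim: n => [|n IHn]; first by rewrite big_ord1 !mul1r.
have -> : (x ^_ n.+1)%:R = (x ^_ n)%:R * (x%:R - n%:R) :> R.
  (* Subtraction in [nat] is truncated, but for [x < n] both sides vanish with [x ^_ n]. *)
  rewrite ffactnSr natrM; case: (leqP n x) => [lenx|ltxn]; first by rewrite natrB.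
  by rewrite ffact_small // !mul0r.
rewrite mulrBr; pose t j : R := (-1) ^+ j * (stirling1_rev n j)%:R * x%:R ^+ (n.+1 - j).
pose t' j : R := (-1) ^+ j.+1 * (n * stirling1_rev n j)%:R * x%:R ^+ (n - j).
have -> : (x ^_ n)%:R * x%:R = \sum_(j < n.+2) t j.
  rewrite big_ord_recr /= /t (stirling1_rev_gt (ltnSn n)) mulr0 mul0r addr0.
  rewrite IHn mulr_suml; apply: eq_bigr => j _.
  by rewrite subSn ?exprSr ?mulrA // -ltnS.
have -> : - ((x ^_ n)%:R * n%:R) = \sum_(j < n.+1) t' j.
  rewrite IHn mulr_suml -sumrN; apply: eq_bigr => j _.
  by rewrite /t' exprS natrM; ring.
rewrite [X in X + _]big_ord_recl [RHS]big_ord_recl -addrA -big_split /=.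
congr (_ + _); first by rewrite /t addn0.
apply: eq_bigr => j _; rewrite /t /t' /bump !add1n subSS natrD.
by rewrite mulrDr mulrDl.
Qed.

(* Both sides have the same sums over all pairs of subsets of [A] and [B], hence
   they agree by induction on [#|A| + #|B|]. *)
Lemma card_supported_sets (I J : finType) (n : nat) (A : {set I}) (B : {set J}) :
  n`!%:R * #|supported_sets n A B|%:R = \sum_(j < n.+1)
    (-1) ^+ j * (stirling1_rev n j)%:R
      * (surj_num #|A| (n - j) * surj_num #|B| (n - j))%:R :> R.
Proof.
pose f (A : {set I}) (B : {set J}) : R := n`!%:R * #|supported_sets n A B|%:R.
pose g (A : {set I}) (B : {set J}) : R := \sum_(j < n.+1)
  (-1) ^+ j * (stirling1_rev n j)%:R
    * (surj_num #|A| (n - j) * surj_num #|B| (n - j))%:R.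
rewrite -/(f A B) -/(g A B).
have sumfg (A' : {set I}) (B' : {set J}) :
    \sum_(AB : {set I} * {set J} | (AB.1 \subset A') && (AB.2 \subset B'))
      f AB.1 AB.2 =
    \sum_(AB : {set I} * {set J} | (AB.1 \subset A') && (AB.2 \subset B'))
      g AB.1 AB.2.
  (* The factorial turns the binomial coefficient into a falling factorial, and each power of
     [#|A'| * #|B'|] is a product of two subset sums of surjection numbers. *)
  rewrite -mulr_sumr -natr_sum sum_supported_sets -natrM mulnC bin_ffact.
  rewrite ffact_stirling1_rev exchange_big /=; apply: eq_bigr => j _.
  rewrite -mulr_sumr -natr_sum -natrX expnMn -!sum_subset_surj_num.
  rewrite big_distrl /=.
  under eq_bigr => A1 _ do rewrite big_distrr.
  by rewrite pair_big.
have [k] := ubnP (#|A| + #|B|)%N; elim: k A B => // k IHk A B ltk.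
have := sumfg A B.
rewrite (bigD1 (A, B)) /= ?subxx // [in RHS](bigD1 (A, B)) /= ?subxx //.
rewrite (eq_bigr (fun AB => g AB.1 AB.2)) => [/addIr//|[A1 B1] /=].
rewrite xpair_eqE negb_and => /andP[/andP[sA sB] neq]; apply: IHk.
apply: leq_trans (_ : #|A| + #|B| <= k)%N => //.
have [eA|nA] := eqVneq A1 A.
  rewrite eA ltn_add2l; apply: proper_card; rewrite finset.properEneq sB andbT.
  by move: neq; rewrite eA eqxx.
rewrite -addSn leq_add ?subset_leq_card //; apply: proper_card.
by rewrite finset.properEneq nA.
Qed.

(** A matrix is identified with its set of ones; having no zero row or column means that both
    projections are full. *)
Lemma card_incidence_supported (n p q : nat) :
  #|[pred M : 'M[bool]_(p, q) | incidence M && (num_ones M == n)]| =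
  #|supported_sets n [set: 'I_p] [set: 'I_q]|.
Proof.
pose h (M : 'M[bool]_(p, q)) := [set ij : 'I_p * 'I_q | M ij.1 ij.2].
have h_inj : injective h.
  move=> M M' /setP eM; apply/matrixP => i j.
  by have := eM (i, j); rewrite !inE.
rewrite -(card_imset _ h_inj); congr #|pred_of_set _|; apply/setP => E.
apply/imsetP/idP => [[M]|].
  rewrite !inE => /andP[/andP[/forallP hr /forallP hc] hn ->].
  rewrite cardsE hn /=; apply/andP; split; apply/eqP/setP => i; rewrite inE.
    by have /existsP[j Mij] := hr i; apply/imsetP; exists (i, j); rewrite ?inE.
  by have /existsP[j Mij] := hc i; apply/imsetP; exists (j, i); rewrite ?inE.
rewrite inE => /and3P[hn /eqP/setP h1 /eqP/setP h2].
have hE : h (\matrix_(i, j) ((i, j) \in E)) = E.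
  by apply/setP => -[i j]; rewrite inE mxE.
exists (\matrix_(i, j) ((i, j) \in E)) => //; rewrite inE /=.
apply/andP; split; last by rewrite /num_ones -cardsE -/(h _) hE.
apply/andP; split; apply/forallP => i; apply/existsP.
  have := h1 i; rewrite inE => /imsetP[[i' j] /= Eij ->]; exists j.
  by rewrite mxE.
have := h2 i; rewrite inE => /imsetP[[j i'] /= Eij ->]; exists j.
by rewrite mxE.
Qed.

(** In the sum of [card_supported_sets] over all shapes the surjection numbers factor into a sum
    over [p] and a sum over [q], each a Fubini number. *)
Lemma F_stirling (n : nat) : n`!%:R * (F n)%:R = \sum_(j < n.+1)
  (-1) ^+ j * (stirling1_rev n j)%:R * (fubini_num (n - j))%:R ^+ 2 :> R.
Proof.
rewrite F_sum natr_sum mulr_sumr.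
under eq_bigr => p _.
  rewrite natr_sum mulr_sumr.
  under eq_bigr => q _ do
    rewrite card_incidence_supported card_supported_sets !cardsT !card_ord.
  rewrite exchange_big; over.
rewrite exchange_big /=; apply: eq_bigr => j _.
under eq_bigr => p _ do rewrite -mulr_sumr -natr_sum -big_distrr /=.
rewrite -mulr_sumr -natr_sum -big_distrl /=.
by rewrite !fubini_num_widen ?ltnS ?leq_subr // natrM -expr2.
Qed.

End StirlingFormula.

Local Open Scope classical_set_scope.

(** * Dominated convergence and a renewal theorem *)

Section Series.
Variable R : realType.
Implicit Types (M g r u : R ^nat) (f : nat -> nat -> R).

(** Tannery's theorem for sums of growing length: the sum is cut at a [K] beyond which the tails are
    small, and the head converges termwise. *)
Lemma cvg_sum_dominated f g M (l : R) :
  (forall n j, (j <= n)%N -> `|f n j| <= M j) -> cvgn (series M) ->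
  (forall j, f n j @[n --> \oo] --> g j) -> series g @ \oo --> l ->
  \sum_(j < n.+1) f n j @[n --> \oo] --> l.
Proof.
move=> lefM cvM cvf cvg_l.
have gM j : `|g j| <= M j.
  apply: (cvgr_to_le (cvg_norm (cvf j))).
  by near=> n; apply: lefM; near: n; exact: nbhs_infty_ge.
have M0 j : 0 <= M j by apply: le_trans (gM j).
have nd : nondecreasing_seq (series M) by apply: nondecreasing_series.
have tailM (K n : nat) : (K <= n)%N ->
    \sum_(K <= j < n) M j <= limn (series M) - series M K.
  move=> leKn; rewrite -sub_series_geq // lerB //.
  exact: nondecreasing_cvgn_le.
apply/cvgrPdist_le => e e0.
have e4 : 0 < e / 4 by lra.
have [K _ KP] : \forall K \near \oo,
    `|limn (series M) - series M K| <= e / 4 /\ `|l - series g K| <= e / 4.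
  near=> K; split; near: K.
    by move/cvgrPdist_le : cvM; apply.
  by move/cvgrPdist_le : cvg_l; apply.
have {KP}[K1 K2] := KP K (leqnn K).
have cvK : \sum_(0 <= j < K) f n j @[n --> \oo] --> series g K.
  rewrite /series /=; under eq_fun do rewrite big_mkord.
  by rewrite big_mkord; apply: cvg_big => [|j _]; [exact: add_continuous|exact: cvf].
near=> n.
have leKn : (K <= n.+1)%N by apply: leqW; near: n; exact: nbhs_infty_ge.
have fK : `|series g K - \sum_(0 <= j < K) f n j| <= e / 4.
  by near: n; move/cvgrPdist_le : cvK; apply.
have ft : `|\sum_(K <= j < n.+1) f n j| <= e / 4.
  apply: le_trans (ler_norm_sum _ _ _) _.
  apply: le_trans (_ : \sum_(K <= j < n.+1) M j <= _).
    by apply: ler_sum_nat => j /andP[_ ltjn]; apply: lefM.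
  by apply: le_trans (tailM _ _ leKn) _; apply: le_trans (ler_norm _) K1.
rewrite -(big_mkord predT (f n)) (big_cat_nat (leq0n K) leKn) //=.
move: K2 fK ft.
set a := series g K; set b := (\sum_(_ <= _ < K) _); set c := (\sum_(K <= _ < _) _).
move=> K2 fK ft; rewrite (_ : l - (b + c) = (l - a) + (a - b) - c); last by ring.
apply: le_trans (ler_normB _ _) _; apply: le_trans (lerD (ler_normD _ _) (lexx _)) _.
lra.
Unshelve. all: by end_near. Qed.

(* The increments of [u] are absolutely summable: they satisfy a homogeneous
   convolution equation whose non-leading weights sum to [rho < 1]. *)
Lemma renewal_cvg r u (rho mu : R) :
  (forall j, 0 <= r j) -> r 0%N = 1 -> rho < 1 ->
  (forall n, \sum_(j < n) r j.+1 <= rho) -> series r @ \oo --> mu ->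
  (forall k, \sum_(i < k.+1) r (k - i)%N * u i = 1) ->
  u @ \oo --> mu^-1.
Proof.
move=> r_ge0 r0 rho1 ler cvr ur.
pose d k := if k is k'.+1 then u k'.+1 - u k' else u 0%N.
have u0 : u 0%N = 1 by have := ur 0%N; rewrite big_ord1 subnn r0 mul1r.
have udE k : u k = series d k.+1.
  elim: k => [|k IHk]; first by rewrite /series /= big_nat1.
  by rewrite seriesSr -IHk /= addrC subrK.
(* Consecutive convolution equations have the same right-hand side 1, so their difference is
   homogeneous in [d]. *)
have dS k : d k.+1 = - \sum_(i < k.+1) r (k.+1 - i)%N * d i.
  have : \sum_(i < k.+2) r (k.+1 - i)%N * d i = 0.
    rewrite big_ord_recl subn0.
    under eq_bigr => i _ do rewrite lift0 subSS /= mulrBr.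
    rewrite sumrB ur addrA; have := ur k.+1; rewrite big_ord_recl subn0.
    under eq_bigr => i _ do rewrite lift0 subSS.
    by move=> ->; rewrite subrr.
  by rewrite big_ord_recr /= subnn r0 mul1r addrC => /eqP; rewrite addr_eq0 => /eqP.
(* [B] solves [B = 1 + rho * B]: the first increment is 1, and by [dS] the later ones add at most
   [rho] times the previous partial sum. *)
pose B := (1 - rho)^-1.
have B0 : 0 < B by rewrite invr_gt0 subr_gt0.
have dB N : \sum_(0 <= k < N) `|d k| <= B.
  elim: N => [|N IHN]; first by rewrite big_geq // ltW.
  rewrite big_nat_recl // [d 0%N]u0 normr1.
  have -> : B = 1 + rho * B by rewrite /B; field; rewrite subr_eq0 gt_eqF.
  rewrite lerD2l.
  apply: le_trans (_ : rho * \sum_(0 <= k < N) `|d k| <= _); last first.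
    by rewrite ler_wpM2l // (le_trans _ (ler 0%N)) // big_ord0.
  apply: le_trans (_ : \sum_(0 <= k < N) \sum_(0 <= i < N | (i <= k)%N)
      r (k.+1 - i)%N * `|d i| <= _).
    apply: ler_sum_nat => k ltkN; rewrite dS normrN.
    apply: le_trans (ler_norm_sum _ _ _) _.
    rewrite -(big_mkord predT (fun i => `|r (k.+1 - i)%N * d i|)).
    rewrite (big_nat_widen _ _ N) //= ler_sum // => i _.
    by rewrite normrM (ger0_norm (r_ge0 _)).
  (* For fixed [i] the weights are [r 1, r 2, ...], each taken once, with sum at most [rho]. *)
  rewrite (exchange_big_dep predT) //= mulr_sumr.
  apply: ler_sum_nat => i /= ltiN; rewrite -mulr_suml ler_wpM2r //.
  rewrite -(big_nat_widenl i 0 N predT (fun k => r (k.+1 - i)%N)) //.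
  rewrite -[X in \sum_(X <= _ < _) _]add0n big_addn big_mkord.
  by under eq_bigr => k _ do rewrite -addSn addnK.
have cvd : cvgn (series d).
  apply: normed_cvg; apply: nondecreasing_is_cvgn.
    by apply: nondecreasing_series => k _ _; exact: normr_ge0.
  by exists B => _ [n _ <-]; exact: dB.
have cvu : u @ \oo --> limn (series d).
  have -> : u = [sequence series d n.+1]_n by apply/funext => k; exact: udE.
  by rewrite cvg_shiftS.
have uB k : `|u k| <= B.
  by rewrite udE; apply: le_trans (ler_norm_sum _ _ _) (dB _).
(* Now that [u] converges, the limit of the convolution equation shows that [mu] times the limit of
   [u] is 1. *)
have : \sum_(j < n.+1) r j * u (n - j)%N @[n --> \oo] --> mu * limn (series d).
  apply: (@cvg_sum_dominated (fun n j => r j * u (n - j)%N)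
    (fun j => r j * limn (series d)) (fun j => r j * B)).
  - by move=> n j _; rewrite normrM (ger0_norm (r_ge0 j)) ler_wpM2l.
  - apply/cvg_ex; exists (mu * B).
    have -> : series (fun j => r j * B) = (fun n => series r n * B).
      by apply/funext => n; rewrite /series /= mulr_suml.
    by apply: cvgMl.
  - by move=> j; apply: cvgMr; rewrite cvg_centern.
  - have -> : series (fun j => r j * limn (series d)) = (fun n => series r n * limn (series d)).
      by apply/funext => n; rewrite /series /= mulr_suml.
    by apply: cvgMl.
have -> : (fun n => \sum_(j < n.+1) r j * u (n - j)%N) = (fun=> 1).
  apply/funext => n; rewrite -[RHS](ur n) (reindex_inj rev_ord_inj) /=.
  by apply: eq_bigr => j _; rewrite subSS subKn // -ltnS.
move=> /(cvg_unique (@Rhausdorff R)) /(_ (@cvg_cst _ _ _ _ _)) e.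
have mu0 : mu != 0 by apply/eqP => mu0; move/eqP: e; rewrite mu0 mul0r eq_sym oner_eq0.
by rewrite -[mu^-1]mulr1 -e mulKf in cvu *.
Qed.

End Series.

(** * Asymptotics of Stirling numbers near the diagonal *)

Section StirlingRatio.
Variable R : realType.

(** The weight left in the [j]-th term of [F_stirling] after each Fubini number is scaled by its
    factorial and the sum is divided by the square of n!. *)
Definition stirling_ratio (n j : nat) : R :=
  (stirling1_rev n j)%:R * ((n - j)`!%:R / n`!%:R) ^+ 2.

Local Notation a := stirling_ratio.

Lemma stirling_ratio0 (n : nat) : a n 0 = 1.
Proof.
rewrite /a subn0 divff ?pnatr_eq0 -?lt0n ?fact_gt0 // expr1n mulr1.
by elim: n => //= n; rewrite addn0.
Qed.

Lemma stirling_ratio_gt (n j : nat) : (n < j)%N -> a n j = 0.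
Proof. by move=> ltnj; rewrite /a stirling1_rev_gt // mul0r. Qed.

Lemma stirling_ratio_ge0 (n j : nat) : 0 <= a n j.
Proof. by rewrite mulr_ge0 // sqr_ge0. Qed.

Lemma stirling_ratioS (n j : nat) : a n.+1 j.+1 =
  (1 - j.+1%:R / n.+1%:R) ^+ 2 * a n j.+1 + n%:R / n.+1%:R ^+ 2 * a n j.
Proof.
have n1 : n.+1%:R != 0 :> R by rewrite pnatr_eq0.
have nf : n`!%:R != 0 :> R by rewrite pnatr_eq0 -lt0n fact_gt0.
rewrite /a /= subSS factS natrD !natrM.
(* For [n <= j] the truncated [n - j.+1] occurs only next to [stirling1_rev n j.+1], which is 0. *)
case: (ltnP j n) => [ltjn|lenj]; last first.
  by rewrite stirling1_rev_gt //; move: (n.+1%:R : R) n1 => N n1; field; rewrite n1 nf.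
have -> : (n - j)`!%:R = (n.+1%:R - j.+1%:R) * (n - j.+1)`!%:R :> R.
  by rewrite -natrB ?ltnS 1?ltnW // subSS -natrM -[in RHS](subnSK ltjn) -factS subnSK.
move: (n.+1%:R : R) n1 => N n1.
by field; rewrite n1 nf.
Qed.

(** With [x = (j + 1) / (n + 1)], the coefficients in [stirling_ratioS] are at most [1 - x] and
    [1 / (n + 1)], and these reproduce the bound exactly. *)
Lemma stirling_ratio_le (n j : nat) : a n j <= j`!%:R^-1.
Proof.
elim: n j => [|n IHn] [|j]; rewrite ?stirling_ratio0 ?invr1 //.
  by rewrite stirling_ratio_gt.
have [ltnj|lejn] := ltnP n j.
  by rewrite stirling_ratio_gt.
rewrite stirling_ratioS.
have n1 : 0 < n.+1%:R :> R by rewrite ltr0n.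
have j1 : 0 < j.+1%:R :> R by rewrite ltr0n.
have jf : 0 < j`!%:R :> R by rewrite ltr0n fact_gt0.
set x : R := j.+1%:R / n.+1%:R.
have x0 : 0 <= x by rewrite divr_ge0 // ltW.
have x1 : x <= 1 by rewrite ler_pdivrMr // mul1r ler_nat.
have -> : j.+1`!%:R^-1 = (1 - x) * j.+1`!%:R^-1 + n.+1%:R^-1 * j`!%:R^-1 :> R.
  by rewrite /x factS natrM; field; rewrite !gt_eqF.
apply: lerD; apply: ler_pM => //; rewrite ?sqr_ge0 ?stirling_ratio_ge0 //.
- by rewrite expr2 ler_piMr //; lra.
- rewrite expr2 ler_pdivrMr ?mulr_gt0 // mulrA mulVf ?gt_eqF // mul1r.
  by rewrite ler_nat.
Qed.

(* The increments of [n * y n] control [y] through Cesaro means. *)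
Lemma cvg0_of_increment_le (y e : R ^nat) (m : nat) :
  (forall n, 0 <= y n) -> e @ \oo --> 0 ->
  (forall n, (m <= n)%N -> n.+1%:R * y n.+1 <= n%:R * y n + e n) ->
  y @ \oo --> 0.
Proof.
move=> y0 ce le_y.
(* The increments are bounded only from above, so their positive parts are taken; these tend to 0
   and their partial sums dominate [n * y n]. *)
pose b n : R := Num.max 0 (n.+1%:R * y n.+1 - n%:R * y n).
have b0 : b @ \oo --> 0.
  apply: (@squeeze_cvgr _ _ _ _ (fun=> 0) (fun n => `|e n|)).
  - near=> n; rewrite /b le_max lexx /= ge_max normr_ge0 /=.
    rewrite lerBlDl; apply: le_trans (le_y n _) _.
      by near: n; exact: nbhs_infty_ge.
    by rewrite lerD2l ler_norm.
  - exact: cvg_cst.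
  - by rewrite -(@normr0 _ R); apply: cvg_norm.
have yb n : n%:R * y n <= series b n.
  elim: n => [|n IHn]; first by rewrite mul0r /series /= big_geq.
  rewrite seriesSr; apply: le_trans (lerD IHn (lexx _)).
  by rewrite -lerBlDl /b le_max lexx orbT.
rewrite -cvg_shiftS; apply: (squeeze_cvgr (f := fun=> 0) _ _ (cesaro b0)).
  near=> n; rewrite /= y0 /arithmetic_mean /=.
  by rewrite mulrC ler_pdivlMr ?ltr0n // mulrC yb.
exact: cvg_cst.
Unshelve. all: by end_near. Qed.

Lemma cvg_stirling_ratio (j : nat) :
  a n j @[n --> \oo] --> ((2 ^+ j * j`!%:R)^-1 : R).
Proof.
elim: j => [|j IHj].
  under eq_fun do rewrite stirling_ratio0.
  by rewrite mul1r invr1; exact: cvg_cst.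
set dj := (X in _ --> X) in IHj.
set d' := (X in _ --> X); pose m : R := j.+1%:R.
have m0 : 0 < m by rewrite ltr0n.
(* The balance forced by the recurrence: [N * (1 - m / N) ^ 2] is [N - 2 * m] up to [O(1 / N)], so a
   limit [d'] needs [2 * m * d' = dj]. *)
have dE : dj = 2 * m * d'.
  have jf : j`!%:R != 0 :> R by rewrite pnatr_eq0 -lt0n fact_gt0.
  have p2 : 2 ^+ j != 0 :> R by rewrite expf_neq0 // pnatr_eq0.
  rewrite /dj /d' factS natrM exprS -/m; move: (m) m0 => m' m'0.
  by field; rewrite jf p2 gt_eqF.
(* Here [m * dj / 2] equals [m ^ 2 * d'], from the second-order term of that square. *)
pose e n := `|a n j - dj| + (m * dj / 2 + a n j) * n.+1%:R^-1.
suff : `|a n j.+1 - d'| @[n --> \oo] --> 0.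
  by move=> /norm_cvg0 /subr_cvg0.
apply: (@cvg0_of_increment_le _ e j) => //.
  rewrite (_ : 0 = `|dj - dj| + (m * dj / 2 + dj) * 0); last first.
    by rewrite subrr normr0 mulr0 addr0.
  apply: cvgD; first by apply: cvg_norm; apply: cvgB => //; exact: cvg_cst.
  apply: cvgM; first by apply: cvgD => //; exact: cvg_cst.
  exact: cvg_harmonic.
move=> n lejn.
have N0 : 0 < n.+1%:R :> R by rewrite ltr0n.
have nE : n%:R = n.+1%:R - 1 :> R by rewrite -natr1 addrK.
have a0 := stirling_ratio_ge0 n j.
have dj0 : 0 <= dj by rewrite invr_ge0 mulr_ge0.
have m1 : 1 <= m by rewrite ler1n.
have mN : m <= n.+1%:R by rewrite ler_nat.
set N : R := n.+1%:R in N0 nE mN *.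
rewrite -[X in X * _](ger0_norm (ltW N0)) -normrM.
have -> : N * (a n.+1 j.+1 - d') = N * (1 - m / N) ^+ 2 * (a n j.+1 - d') +
    ((a n j - dj) + (m * dj / 2 - a n j) * N^-1).
  by rewrite stirling_ratioS -/N -/m nE dE; field; rewrite gt_eqF.
apply: le_trans (ler_normD _ _) _; apply: lerD.
  rewrite normrM ler_wpM2r // ger0_norm; last by rewrite mulr_ge0 ?sqr_ge0 // ltW.
  have -> : N * (1 - m / N) ^+ 2 = (N - m) * ((N - m) / N).
    by field; rewrite gt_eqF.
  (* Since [1 <= m <= N], the coefficient is at most [N - m], hence at most [N - 1 = n]. *)
  apply: le_trans (_ : N - m <= _); last by rewrite nE; lra.
  rewrite ler_piMr ?subr_ge0 // ler_pdivrMr //; lra.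
have Ni : 0 <= N^-1 by rewrite invr_ge0 ltW.
apply: le_trans (ler_normD _ _) _; rewrite lerD2l normrM (ger0_norm Ni).
rewrite ler_wpM2r //; apply: le_trans (ler_normB _ _) _.
by rewrite !ger0_norm // divr_ge0 // mulr_ge0 // ltW.
Qed.

End StirlingRatio.

(** * Asymptotics of the Fubini numbers *)

Section Fubini.
Variable R : realType.

Local Notation L := (ln 2 : R).
Local Notation c := (exp_coeff L).

(** The sum of [c i] over [i > j], since the whole series is [exp (log 2) = 2]. *)
Definition exp_ln2_tail (j : nat) : R := 2 - series c j.+1.
Definition fubini_ratio (k : nat) : R := (fubini_num k)%:R * L ^+ k / k`!%:R.

Local Notation r := exp_ln2_tail.
Local Notation u := fubini_ratio.

Lemma ln2_gt0 : 0 < L.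
Proof. by rewrite ln_gt0 // ltr1n. Qed.

Lemma ln2_lt1 : L < 1.
Proof.
rewrite -ltr_expR lnK ?posrE //.
by have := @expR_gt1Dx R 1 (oner_neq0 _).
Qed.

Lemma cvg_series_exp_ln2 : series c @ \oo --> (2 : R).
Proof.
have : series c @ \oo --> expR L by exact: is_cvg_series_exp_coeff.
by rewrite lnK // posrE.
Qed.

Lemma exp_ln2_coeffS (n : nat) : n.+1%:R * c n.+1 = L * c n.
Proof.
have n1 : n.+1%:R != 0 :> R by rewrite pnatr_eq0.
have nf : n`!%:R != 0 :> R by rewrite pnatr_eq0 -lt0n fact_gt0.
rewrite /exp_coeff /= factS natrM exprS; move: (n.+1%:R : R) n1 => N n1.
by field; rewrite n1 nf.
Qed.

Lemma exp_ln2_tailS (j : nat) : r j.+1 = r j - c j.+1.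
Proof. by rewrite /r seriesSr opprD addrA. Qed.

Lemma exp_ln2_tail0 : r 0 = 1.
Proof.
rewrite /r /series /= big_nat1 /exp_coeff /= expr0 fact0 divr1; lra.
Qed.

Lemma exp_ln2_tail_ge0 (j : nat) : 0 <= r j.
Proof.
have nd : nondecreasing_seq (series c).
  by apply: nondecreasing_series => n _ _; apply: exp_coeff_ge0; exact: ltW ln2_gt0.
have := nondecreasing_cvgn_le nd (cvgP _ cvg_series_exp_ln2) j.+1.
by rewrite (cvg_lim (@Rhausdorff R) cvg_series_exp_ln2) subr_ge0.
Qed.

(** Summation by parts, with [i * c i] replaced by [L * c (i - 1)]. *)
Lemma series_exp_ln2_tail (n : nat) : series r n = n%:R * r n + L * series c n.
Proof.
elim: n => [|n IHn]; first by rewrite /series /= !big_geq // mul0r mulr0 addr0.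
rewrite seriesSr IHn (seriesSr c) [L * (_ + _)]mulrDr -exp_ln2_coeffS exp_ln2_tailS.
by rewrite -natr1; ring.
Qed.

(* Termwise, [(n + 1) * c i <= i * c i = L * c (i - 1)] for [i > n + 1]. *)
Lemma exp_ln2_tail_le (n : nat) : n.+1%:R * r n.+1 <= L * r n.
Proof.
have le p : n.+1%:R * (series c (p + n.+2)%N - series c n.+2)
    <= L * (series c (p + n.+1)%N - series c n.+1).
  elim: p => [|p IHp]; first by rewrite !add0n !subrr !mulr0.
  have le_c : n.+1%:R * c (p + n.+2)%N <= L * c (p + n.+1)%N.
    rewrite -exp_ln2_coeffS -addnS (ler_wpM2r (exp_coeff_ge0 _ (ltW ln2_gt0))) //.
    by rewrite ler_nat addnS ltnS (leq_trans (leqnSn n)) // leq_addl.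
  rewrite !addSn !(seriesSr _ (p + _)) (addrAC _ _ (- series c n.+2)).
  by rewrite (addrAC _ _ (- series c n.+1)) !(mulrDr _ (_ - _)) lerD.
have cv (k : nat) (x : R) :
    x * (series c (p + k)%N - series c k) @[p --> \oo] --> x * (2 - series c k).
  apply: cvgMr; apply: cvgB; last exact: cvg_cst.
  by rewrite (cvg_shiftn k (series c)); exact: cvg_series_exp_ln2.
by apply: (ler_cvg_to (cv n.+2 n.+1%:R) (cv n.+1 L)); exact: nearW.
Qed.

Lemma series_exp_ln2_tail_le (n : nat) : series r n.+1 <= 2 * L.
Proof.
rewrite series_exp_ln2_tail; apply: le_trans (lerD (exp_ln2_tail_le n) (lexx _)) _.
by rewrite /r -mulrDr subrK mulrC.
Qed.

Lemma cvg_series_exp_ln2_tail : series r @ \oo --> 2 * L.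
Proof.
rewrite -cvg_shiftS.
apply: (squeeze_cvgr (f := fun n => series c n.+1 * L) (h := fun=> 2 * L)).
- near=> n; rewrite /= series_exp_ln2_tail_le andbT series_exp_ln2_tail mulrC.
  by rewrite lerDr mulr_ge0 // exp_ln2_tail_ge0.
- apply: cvgMl; rewrite (cvg_shiftS (series c)); exact: cvg_series_exp_ln2.
- exact: cvg_cst.
Unshelve. all: by end_near. Qed.

Lemma fubini_ratio_ge0 (k : nat) : 0 <= u k.
Proof. by rewrite divr_ge0 // mulr_ge0 // exprn_ge0 // ltW // ln2_gt0. Qed.

Lemma fubini_ratio_rec (k : nat) :
  u k = (k == 0%N)%:R + \sum_(j < k) c (k - j)%N * u j.
Proof.
rewrite {1}/u fubini_num_rec natrD !mulrDl; congr (_ + _).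
  by case: k => [|k]; rewrite ?expr0 ?fact0 ?mulr1 ?divr1 // !mul0r.
rewrite natr_sum !mulr_suml; apply: eq_bigr => j _.
have lejk : (j <= k)%N := ltnW (ltn_ord j).
rewrite /u /exp_coeff /= -(bin_fact lejk) !natrM.
have -> : L ^+ k = L ^+ (k - j) * L ^+ j by rewrite -exprD subnK.
by field; rewrite !pnatr_eq0 -!lt0n !fact_gt0 bin_gt0 lejk.
Qed.

(** The sum does not depend on [k]: passing to [k.+1] lowers the old terms by the convolution of [c]
    and [u], which is the new term [u k.+1]. *)
Lemma sum_fubini_ratio (k : nat) : \sum_(i < k.+1) r (k - i)%N * u i = 1.
Proof.
elim: k => [|k IHk].
  by rewrite big_ord1 exp_ln2_tail0 fubini_ratio_rec big_ord0 addr0 mulr1.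
rewrite big_ord_recr /= subnn exp_ln2_tail0 mul1r [u k.+1]fubini_ratio_rec add0r.
rewrite -big_split -[RHS]IHk; apply: eq_bigr => i _ /=.
rewrite subSn; last by rewrite -ltnS.
by rewrite exp_ln2_tailS -mulrDl subrK.
Qed.

Lemma fubini_ratio_le1 (k : nat) : u k <= 1.
Proof.
rewrite -(sum_fubini_ratio k) big_ord_recr /= subnn exp_ln2_tail0 mul1r lerDr.
by apply: sumr_ge0 => i _; rewrite mulr_ge0 ?exp_ln2_tail_ge0 ?fubini_ratio_ge0.
Qed.

Lemma cvg_fubini_ratio : u @ \oo --> (2 * L)^-1.
Proof.
(* The tails sum to [2 * L]; removing [r 0 = 1] leaves [2 * L - 1], below 1 because [L < 1]. *)
apply: (@renewal_cvg _ r u (2 * L - 1)).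
- exact: exp_ln2_tail_ge0.
- exact: exp_ln2_tail0.
- by have := ln2_lt1; lra.
- move=> n; rewrite lerBrDl; apply: le_trans (series_exp_ln2_tail_le n).
  by rewrite /series /= big_mkord big_ord_recl exp_ln2_tail0.
- exact: cvg_series_exp_ln2_tail.
- exact: sum_fubini_ratio.
Qed.

End Fubini.

(** * Normalisation of the exact formula and passage to the limit *)

Theorem theorem1 (R : realType) :
  ((F n)%:R : R) /
    (n`!%:R / 4 * expR (- (1 / 2) * (ln 2) ^+ 2) * (1 / (ln 2) ^+ (2 * n + 2)))
    @[n --> \oo] --> (1 : R).
Proof.
set L : R := ln 2; set E := expR _.
have L0 : L != 0 by rewrite gt_eqF // ln2_gt0.
have E0 : E != 0 by rewrite expR_eq0.
(* The normaliser's [4 * L ^ 2] enters the square, where [2 * L] makes the Fubini factor tend to 1;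
   [L ^ (2 * j)] is what [L ^ (2 * n)] leaves beside [L ^ (2 * (n - j))]. *)
pose f n j : R := (-1) ^+ j * stirling_ratio R n j * L ^+ 2 ^+ j
  * (2 * L * fubini_ratio R (n - j)) ^+ 2.
have -> : (fun n => (F n)%:R /
    (n`!%:R / 4 * E * (1 / L ^+ (2 * n + 2)))) =
    (fun n => (\sum_(j < n.+1) f n j) / E).
  apply/funext => n.
  have nf : n`!%:R != 0 :> R by rewrite pnatr_eq0 -lt0n fact_gt0.
  have -> : (F n)%:R = n`!%:R^-1 * (n`!%:R * (F n)%:R) :> R by rewrite mulKf.
  rewrite F_stirling mulr_sumr !mulr_suml; apply: eq_bigr => j _.
  have lejn : (j <= n)%N by rewrite -ltnS.
  have njf : (n - j)`!%:R != 0 :> R by rewrite pnatr_eq0 -lt0n fact_gt0.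
  rewrite /f /stirling_ratio /fubini_ratio -/L.
  have -> : L ^+ (2 * n + 2) = L ^+ 2 ^+ j * (L ^+ (n - j)) ^+ 2 * L ^+ 2.
    by rewrite -!exprM -!exprD; congr (_ ^+ _); lia.
  by field; rewrite E0 nf njf L0 !expf_neq0.
rewrite -(divff E0); apply: cvgMl.
(* The dominating series uses [stirling_ratio_le] and [fubini_ratio_le1]; the termwise limits form
   the exponential series of [E]. *)
apply: (@cvg_sum_dominated _ f (exp_coeff (- (1 / 2) * L ^+ 2))
  (fun j => 4 * L ^+ 2 * exp_coeff (L ^+ 2) j)).
- have LL : 0 <= 4 * L ^+ 2 by apply: mulr_ge0 => //; exact: sqr_ge0.
  move=> n j _; rewrite /f 3!normrM normrX normrN1 expr1n mul1r.
  rewrite (ger0_norm (stirling_ratio_ge0 _ _ _)).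
  rewrite (ger0_norm (exprn_ge0 j (sqr_ge0 L))) (ger0_norm (sqr_ge0 _)).
  rewrite mulrC exprMn exprMn.
  rewrite (_ : 2 ^+ 2 = 4 :> R); last by ring.
  rewrite /exp_coeff /= [X in _ <= _ * X]mulrC; apply: ler_pM.
  - by apply: mulr_ge0 LL _; exact: sqr_ge0.
  - by rewrite mulr_ge0 ?stirling_ratio_ge0 // exprn_ge0 // sqr_ge0.
  - rewrite ler_piMr // exprn_ile1 //.
      exact: fubini_ratio_ge0.
    exact: fubini_ratio_le1.
  - by rewrite ler_wpM2r ?stirling_ratio_le // exprn_ge0 // sqr_ge0.
- have -> : series (fun j => 4 * L ^+ 2 * exp_coeff (L ^+ 2) j) =
      (fun n => 4 * L ^+ 2 * series (exp_coeff (L ^+ 2)) n).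
    by apply/funext => n; rewrite /series /= mulr_sumr.
  by apply: is_cvgMr; exact: is_cvg_series_exp_coeff.
- move=> j.
  have -> : exp_coeff (- (1 / 2) * L ^+ 2) j =
      (-1) ^+ j * (2 ^+ j * j`!%:R)^-1 * L ^+ 2 ^+ j * (2 * L * (2 * L)^-1) ^+ 2.
    rewrite divff ?mulf_neq0 // expr1n mulr1 /exp_coeff /= div1r exprMn.
    by rewrite (exprNn (2^-1 : R)) exprVn invfM; ring.
  apply: cvgM; first by apply: cvgMl; apply: cvgMr; exact: cvg_stirling_ratio.
  have h : 2 * L * fubini_ratio R (n - j) @[n --> \oo] --> 2 * L * (2 * L)^-1.
    by apply: cvgMr; rewrite cvg_centern; exact: cvg_fubini_ratio.
  by apply: cvgM.
- exact: is_cvg_series_exp_coeff.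
Qed.
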